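(* Suppose $Y\sim\sum_{k=1}^K\pi_kN(\mu_k,\sigma_k^2)$, with $\sum_{k=1}^K\pi_k=1$, where $K$, the mixing proportions $\pi_k$, and the component parameters $\mu_k\in\mathbb{R}$, $\sigma_k^2>0$ are all unknown. Let $G$ denote the indicator of the latent mixture component of $Y$, and suppose $$P(R=1\mid y,G=k)=F\left[\frac{\alpha\psi(\sigma_k)+\beta\{y-\kappa(\mu_k)\}}{\varphi(\sigma_k)}\right],$$ where $\alpha,\beta\in\mathbb{R}$ are unknown, $\psi,\kappa,\varphi$ are known functions such that $\kappa$ and $\varphi$ are increasing (non-strictly; constants are allowed) and $\psi$ and $\varphi$ are positive, and $F$ is a known strictly monotone distribution function with support on $(-\infty,+\infty)$. Suppose that $F$ satisfies both of the following conditions: (A) for every $\delta>0$, $\lim_{z\to-\infty}F(z)/e^{\delta z}$ equals $0$ or $+\infty$; (B) for every $\theta_0\in(-\infty,+\infty)$, $\theta_1>0$, and $\delta_1,\delta_2\ge0$ with $\delta_1+\delta_2\neq0$, the limit $\lim_{z\to+\infty}\{F(\theta_0+\theta_1z)-F(z)\}/e^{-\delta_1z^2-\delta_2z}$ equals $0$ or $\infty$ (infinity being understood in absolute value, as the quotient may be negative). Then the parameters $K$, $\{(\pi_k,\mu_k,\sigma_k^2):k=1,\ldots,K\}$, $\alpha$ and $\beta$ are identifiable.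
   Context: $Y$ is an outcome variable and $R\in\{0,1\}$ is its missingness indicator ($R=1$ if $Y$ is observed). The latent component $G$ satisfies $P(G=k)=\pi_k$ and $Y\mid G=k\sim N(\mu_k,\sigma_k^2)$; $G$ is not observed. The observed distribution is $P(y,R=1)$, which here is the function $y\mapsto\sum_{k=1}^K\frac{\pi_k}{\sigma_k}\phi\left(\frac{y-\mu_k}{\sigma_k}\right)F\left[\frac{\alpha\psi(\sigma_k)+\beta\{y-\kappa(\mu_k)\}}{\varphi(\sigma_k)}\right]$, where $\phi$ is the standard normal density. Mixtures are written with $\pi_k>0$ and distinct pairs $(\mu_k,\sigma_k^2)$. The parameters are identifiable if any two parameter sets yielding the same observed distribution have the same $K$, the same set $\{(\pi_k,\mu_k,\sigma_k^2)\}$ (i.e. equality up to relabelling of components), and the same $\alpha,\beta$. *)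

(* Defs.v *)
From mathcomp Require Import all_boot all_order all_algebra.
From mathcomp Require Import all_classical all_reals all_analysis.

Set Implicit Arguments.
Unset Strict Implicit.
Unset Printing Implicit Defensive.

Import Order.TTheory GRing.Theory Num.Theory.
Import numFieldNormedType.Exports.

Local Open Scope classical_set_scope.
Local Open Scope ring_scope.

Record mixture_params (R : realType) := MixtureParams {
  ncomp : nat;
  weight : 'I_ncomp -> R;
  mean : 'I_ncomp -> R;
  variance : 'I_ncomp -> R;
  alpha : R;
  beta : R }.

Definition sd (R : realType) (p : mixture_params R) (k : 'I_(ncomp p)) : R :=
  Num.sqrt (variance k).

(* The weights summing to 1 forces at least one component. *)
Definition admissible (R : realType) (p : mixture_params R) : Prop :=
  [/\ forall k : 'I_(ncomp p), 0 < weight k,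
      \sum_(k < ncomp p) weight k = 1,
      forall k : 'I_(ncomp p), 0 < variance k
    & injective (fun k : 'I_(ncomp p) => (mean k, variance k))].

(* P(R = 1 | y, G = k) *)
Definition response_prob (R : realType) (F psi kappa varphi : R -> R)
    (p : mixture_params R) (k : 'I_(ncomp p)) (y : R) : R :=
  F ((alpha p * psi (sd k) + beta p * (y - kappa (mean k))) / varphi (sd k)).

(* P(y, R = 1), with G marginalised out; normal_pdf 0 1 is the standard normal
   density. *)
Definition observed_distribution (R : realType) (F psi kappa varphi : R -> R)
    (p : mixture_params R) (y : R) : R :=
  \sum_(k < ncomp p)
    weight k / sd k * normal_pdf 0 1 ((y - mean k) / sd k) *
    response_prob F psi kappa varphi k y.

Definition components (R : realType) (p : mixture_params R) :
    set (R * R * R) :=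
  range (fun k : 'I_(ncomp p) => (weight k, mean k, variance k)).

Definition same_params (R : realType) (p q : mixture_params R) : Prop :=
  [/\ ncomp p = ncomp q, components p = components q,
      alpha p = alpha q & beta p = beta q].

Definition identifiable (R : realType) (F psi kappa varphi : R -> R) : Prop :=
  forall p q : mixture_params R, admissible p -> admissible q ->
    (forall y : R, observed_distribution F psi kappa varphi p y =
                   observed_distribution F psi kappa varphi q y) ->
    same_params p q.

Definition left_tail_condition (R : realType) (F : R -> R) : Prop :=
  forall delta : R, 0 < delta ->
    (F z / expR (delta * z) @[z --> -oo%R] --> (0 : R)) \/
    (F z / expR (delta * z) @[z --> -oo%R] --> +oo%R).

(* The quotient may be negative, so the infinite case is divergence of its
   absolute value. *)
Definition right_tail_condition (R : realType) (F : R -> R) : Prop :=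
  forall theta0 theta1 delta1 delta2 : R,
    0 < theta1 -> 0 <= delta1 -> 0 <= delta2 -> delta1 + delta2 != 0 ->
    let quotient (z : R) := (F (theta0 + theta1 * z) - F z) /
                            expR (- delta1 * z ^+ 2 - delta2 * z) in
    (quotient z @[z --> +oo%R] --> (0 : R)) \/
    (`|quotient z| @[z --> +oo%R] --> +oo%R).

(* Main.v *)
(* Up to positive constants a component contributes w_i G_i(y) F(u_i + r_i y),
   where G_i(y) = exp(-s_i y^2 + m_i y), s = 1 / (2 sigma^2), m = mu / sigma^2
   and r_i has the sign of beta.  The reflection y |-> -y reduces everything to
   y -> +oo, where G_i dominates G_j if s_i < s_j, or s_i = s_j and m_j < m_i.
   - beta, beta' > 0: let i0 be the dominant component whose weights differ and
     divide by G_i0.  The components with equal weights contribute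
     w_i (G_i / G_i0) (F(u_i + r_i y) - F(u'_i + r'_i y)), all of one sign for
     large y because psi and varphi are positive; their sum converges, so each
     is bounded, and by condition (B) each tends to 0.  Hence the weights at i0
     agree after all.  The one-sign remark then also gives alpha and beta.
   - beta > 0 >= beta': comparing both ends shows that the largest variances
     agree; at -oo the left side is then negligible, by condition (A), against
     a term of the right side that is bounded below.
   - beta = beta' = 0: the Gaussians are linearly independent. *)
Require Import Defs.
From mathcomp Require Import all_boot all_order all_algebra.
From mathcomp Require Import all_classical all_reals all_analysis.
From mathcomp Require Import ring lra.

Import Order.TTheory GRing.Theory Num.Theory.
Import numFieldNormedType.Exports.

Local Open Scope classical_set_scope.
Local Open Scope ring_scope.

Set Implicit Arguments.
Unset Strict Implicit.
Unset Printing Implicit Defensive.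

(* gexp (1 / (2 v)) (mu / v) is the N(mu, v) density up to a constant factor. *)
Definition gexp (R : realType) (s m y : R) : R := expR (- s * y ^+ 2 + m * y).

(** * Gaussian exponentials at infinity *)

Section GaussianExponential.
Context {R : realType}.
Implicit Types s m a b y : R.

Lemma gexp_gt0 s m y : 0 < gexp s m y.
Proof. exact: expR_gt0. Qed.

Lemma gexp_neq0 s m y : gexp s m y != 0.
Proof. by rewrite gt_eqF// gexp_gt0. Qed.

Lemma gexp_div s m s' m' y : gexp s m y / gexp s' m' y = gexp (s - s') (m - m') y.
Proof. by rewrite /gexp -expRN -expRD; congr expR; ring. Qed.

Lemma gexp_affine s m a b y : gexp s m (a + b * y) =
  gexp s m a * gexp (s * b ^+ 2) (b * (m - 2 * s * a)) y.
Proof. by rewrite /gexp -expRD; congr expR; ring. Qed.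

Lemma gexpN s m y : gexp s m (- y) = gexp s (- m) y.
Proof. by rewrite /gexp; congr expR; ring. Qed.

Lemma cvgy_affine a b : 0 < b -> a + b * y @[y --> +oo] --> +oo.
Proof.
move=> b0; apply/cvgryPge => A; near=> y.
suff : (A - a) / b <= y by rewrite ler_pdivrMr// mulrC lerBlDl.
by near: y; apply: nbhs_pinfty_ge; exact: num_real.
Unshelve. all: by end_near. Qed.

Lemma cvgNy_affine a b : b < 0 -> a + b * y @[y --> +oo] --> -oo.
Proof.
move=> b0; apply/cvgrNyPle => A; near=> y.
suff : (A - a) / b <= y by rewrite ler_ndivrMr// mulrC lerBrDl.
by near: y; apply: nbhs_pinfty_ge; exact: num_real.
Unshelve. all: by end_near. Qed.

Lemma gexp_cvg0 s m : 0 < s \/ s = 0 /\ m < 0 ->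
  gexp s m y @[y --> +oo] --> 0.
Proof.
(* The exponent is eventually at most - c y: for s > 0 because s y >= m + 1 for large y, and for s =
   0 because it equals m y. *)
move=> sm; pose c := if 0 < s then 1 else - m.
have c0 : 0 < c.
  rewrite /c; case: ifPn => // sN; case: sm => [s0|[_ ?]]; last by rewrite oppr_gt0.
  by rewrite s0 in sN.
apply: (@squeeze_cvgr _ _ _ _ (fun=> 0) (fun y => expR (- (0 + c * y)))).
- near=> y; rewrite ltW ?gexp_gt0//= ler_expR add0r /c.
  have y0 : 0 <= y by near: y; apply: nbhs_pinfty_ge; exact: num_real.
  case: ifPn => sN.
    have ys : (m + 1) / s <= y by near: y; apply: nbhs_pinfty_ge; exact: num_real.
    rewrite ler_pdivrMr// in ys.
    have := ler_wpM2r y0 ys; rewrite expr2; nra.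
  case: sm => [s0|[-> _]]; first by rewrite s0 in sN.
  by rewrite oppr0 mul0r add0r mulNr opprK.
- exact: cvg_cst.
- exact: (cvg_comp _ (fun x => expR (- x)) (cvgy_affine 0 c0) (@cvgr_expR R)).
Unshelve. all: by end_near. Qed.

End GaussianExponential.

(** * Tails of the distribution function under condition (B) *)

Section Tails.
Context {R : realType} (F : cumulativeBounded (0 : R) (1 : R)).
Hypothesis F_strict : {homo F : x y / x < y}.

Lemma cumulative_le x y : x <= y -> F x <= F y.
Proof. exact: (ltW_homo F_strict). Qed.

Lemma cumulative_le1 x : F x <= 1.
Proof.
apply: (cvgr_to_ge (cumulativey F)); near=> y; apply: cumulative_le.
by near: y; apply: nbhs_pinfty_ge; exact: num_real.
Unshelve. all: by end_near. Qed.

Lemma cumulative_gt0 x : 0 < F x.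
Proof.
apply: (@le_lt_trans _ _ (F (x - 1))); last by apply: F_strict; rewrite ltrBlDr ltrDl.
apply: (cvgr_to_le (cumulativeNy F)); near=> y; apply: cumulative_le.
by near: y; apply: nbhs_ninfty_le; exact: num_real.
Unshelve. all: by end_near. Qed.

Lemma cumulative_cvg1 a b : 0 < b -> F (a + b * y) @[y --> +oo] --> (1 : R).
Proof. by move=> b0; exact: (cvg_comp _ F (cvgy_affine a b0) (cumulativey F)). Qed.

Lemma cumulative_cvg0 a b : b < 0 -> F (a + b * y) @[y --> +oo] --> (0 : R).
Proof. by move=> b0; exact: (cvg_comp _ F (cvgNy_affine a b0) (cumulativeNy F)). Qed.

(** The ratio of the values at z + tau and z is a constant times exp (- 2 s tau z), which tends to
    0; beyond |m| / s the Gaussian decreases, so every larger x inherits the bound. *)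
Lemma near_gexp_shift_le (s m tau : R) : 0 < s -> 0 < tau ->
  \forall z \near +oo, forall x, z + tau <= x -> gexp s m x <= gexp s m z / 2.
Proof.
move=> s0 t0.
have h : gexp s m tau * gexp 0 (- 2 * s * tau) z @[z --> +oo] --> gexp s m tau * 0.
  apply: cvgM; first exact: cvg_cst.
  by apply: gexp_cvg0; right; split => //; nra.
near=> z => x zx.
have le1 : gexp s m tau * gexp 0 (- 2 * s * tau) z <= 2^-1.
  by near: z; apply: (cvgr_le _ h); rewrite mulr0 invr_gt0.
have zm : `|m| / s <= z by near: z; apply: nbhs_pinfty_ge; exact: num_real.
apply: (@le_trans _ _ (gexp s m (tau + 1 * z))).
  rewrite ler_expR; rewrite ler_pdivrMr// in zm.
  have mz := ler_norm m; have m0 := normr_ge0 m.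
  rewrite -subr_ge0.
  rewrite (_ : _ - _ = (x - (tau + 1 * z)) * (s * (x + (tau + z)) - m)); last by ring.
  apply: mulr_ge0; first lra.
  have : z * s <= x * s by apply: ler_wpM2r; lra.
  have : 0 <= z * s by lra.
  have : 0 < tau * s by rewrite mulr_gt0.
  lra.
rewrite gexp_affine mul1r expr1n mulr1.
rewrite [X in _ * X](_ : _ = gexp 0 (- 2 * s * tau) z * gexp s m z); last first.
  by rewrite /gexp -expRD; congr expR; ring.
by rewrite mulrA [leRHS]mulrC ler_wpM2r// ltW// gexp_gt0.
Unshelve. all: by end_near. Qed.

(* Summing F (L (L^n z)) - F (L^n z) over n gives 1 - F z, and the Gaussian
   bounds decay at least geometrically along the orbit of L. *)
Lemma tail_le_of_increment_le (L : R -> R) (s m tau C : R) :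
    0 < s -> 0 < tau -> 0 <= C ->
    (\forall z \near +oo, z + tau <= L z) ->
    (\forall z \near +oo, F (L z) - F z <= C * gexp s m z) ->
  \forall z \near +oo, 1 - F z <= 2 * C * gexp s m z.
Proof.
move=> s0 t0 C0 hL hF.
have [M [_ HM]] : \forall z \near +oo, [/\ z + tau <= L z,
    F (L z) - F z <= C * gexp s m z &
    forall x, z + tau <= x -> gexp s m x <= gexp s m z / 2].
  near=> z; split; [near: z; exact: hL | near: z; exact: hF | ].
  by near: z; exact: near_gexp_shift_le.
(* The induction hypothesis is used at [L z]: C g(z) + 2 C g(L z) <= 2 C g(z) since g halves along
   [L]. The remainder 1 - F (z + n tau) vanishes as n grows. *)
have tele n z : M < z ->
    1 - F z <= 2 * C * gexp s m z + (1 - F (z + n%:R * tau)).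
  elim: n z => [|n IH] z Mz.
    by rewrite mul0r addr0 lerDr !mulr_ge0// ltW// gexp_gt0.
  have [Lz Fz gz] := HM _ Mz.
  have MLz : M < L z by apply: lt_le_trans Lz; lra.
  have := IH _ MLz; have := gz _ Lz => gLz IHz.
  have FF : F (z + n.+1%:R * tau) <= F (L z + n%:R * tau).
    by apply: cumulative_le; rewrite -natr1; lra.
  have : C * gexp s m (L z) <= C * (gexp s m z / 2) by apply: ler_wpM2l.
  lra.
exists M; split; first exact: num_real.
move=> z Mz; apply/ler_addgt0Pr => e e0.
have [N [_ HN]] : \forall x \near +oo, 1 - e <= F x.
  by apply: (cvgr_ge _ (cumulativey F)); rewrite ltrBlDr ltrDl.
pose n := (Num.truncn ((N - z) / tau)).+1.
have : N < z + n%:R * tau.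
  by rewrite -ltrBlDl -ltr_pdivrMr// truncnS_gt.
move/HN; have := tele n _ Mz; rewrite /=; lra.
Unshelve. all: by end_near. Qed.


Lemma near_affine (P : R -> Prop) (a b : R) : 0 < b ->
  (\forall z \near +oo, P z) -> \forall y \near +oo, P (a + b * y).
Proof. by move=> b0 hP; exact: (cvgy_affine a b0 hP). Qed.

Lemma near_expanding (t0 t1 : R) : 1 < t1 \/ t1 = 1 /\ 0 < t0 ->
  exists2 tau, 0 < tau & \forall z \near +oo, z + tau <= t0 + t1 * z.
Proof.
move=> [t1_gt1|[-> t0_gt0]]; last first.
  by exists t0 => //; near=> z; rewrite mul1r addrC.
exists 1 => //; near=> z.
have : (1 - t0) / (t1 - 1) <= z.
  by near: z; apply: nbhs_pinfty_ge; exact: num_real.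
rewrite ler_pdivrMr ?subr_gt0//; lra.
Unshelve. all: by end_near. Qed.

Lemma cvg0_of_dichotomy (f : R -> R) (C : R) :
    f z @[z --> +oo] --> (0 : R) \/ `|f z| @[z --> +oo] --> +oo ->
    (\forall z \near +oo, `|f z| <= C) ->
  f z @[z --> +oo] --> (0 : R).
Proof.
move=> [//|/cvgryPge/(_ (C + 1)) fy] fC; exfalso.
near (pinfty_nbhs R) => z.
have : `|f z| <= C by near: z.
have : C + 1 <= `|f z| by near: z.
lra.
Unshelve. all: by end_near. Qed.

Hypothesis condB : right_tail_condition F.

(** Condition (B) with delta1 = s and delta2 = - m; the assumed bound excludes the infinite
    alternative. *)
Lemma right_tail_gexp (t0 t1 s m C : R) : 0 < t1 -> 0 <= s -> m <= 0 -> s - m != 0 ->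
    (\forall z \near +oo, `|F (t0 + t1 * z) - F z| <= C * gexp s m z) ->
  (F (t0 + t1 * z) - F z) / gexp s m z @[z --> +oo] --> (0 : R).
Proof.
move=> t1_gt0 s0 m0 sm hC.
apply: (@cvg0_of_dichotomy _ C).
  have := condB t0 t1_gt0 s0 (_ : 0 <= - m) sm; rewrite oppr_ge0 => /(_ m0) /=.
  rewrite (_ : (fun z => _ / expR _) =
    (fun z => (F (t0 + t1 * z) - F z) / gexp s m z)); last first.
    by apply/funext => z; congr (_ / expR _); ring.
  rewrite (_ : (fun z => `|_ / expR _|) =
    (fun z => `|(F (t0 + t1 * z) - F z) / gexp s m z|))//.
  by apply/funext => z; congr (`|_ / expR _|); ring.
near=> z; rewrite normrM normfV (gtr0_norm (gexp_gt0 _ _ _)) ler_pdivrMr ?gexp_gt0//.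
by near: z.
Unshelve. all: by end_near. Qed.

(* condB only speaks of m <= 0.  For m > 0 completing the square and replacing
   the affine map by w |-> 2 w - 2 m / s moves the centre of the Gaussian to the
   left; both the hypothesis and the conclusion transfer through 1 - F. *)
Lemma increment_cvg0 (t0 t1 s m C : R) :
    1 < t1 \/ t1 = 1 /\ 0 < t0 -> 0 < s \/ s = 0 /\ m < 0 ->
    (\forall z \near +oo, F (t0 + t1 * z) - F z <= C * gexp s m z) ->
  (F (t0 + t1 * z) - F z) / gexp s m z @[z --> +oo] --> (0 : R).
Proof.
move=> tt sm hC.
have t1_gt0 : 0 < t1 by case: tt => [?|[-> _]]//; lra.
have [tau tau0 htau] := near_expanding tt.
have hpos : \forall z \near +oo, 0 <= F (t0 + t1 * z) - F z.
  near=> z; rewrite subr_ge0; apply: cumulative_le.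
  have : z + tau <= t0 + t1 * z by near: z.
  lra.
have [m0|m0] := leP m 0.
  apply: (@right_tail_gexp _ _ _ _ C) => //.
  - by case: sm => [/ltW//|[->]].
  - by case: sm => [?|[-> ?]]; apply: lt0r_neq0; lra.
  - near=> z; rewrite ger0_norm; last by near: z.
    by near: z.
have s0 : 0 < s by case: sm => [//|[_ ?]]; lra.
have hC' : \forall z \near +oo, F (t0 + t1 * z) - F z <= Num.max C 0 * gexp s m z.
  near=> z; apply: (@le_trans _ _ (C * gexp s m z)); first by near: z.
  by rewrite ler_wpM2r ?le_max ?lexx// ltW// gexp_gt0.
have C0 : 0 <= Num.max C 0 by rewrite le_max lexx orbT.
have hS := tail_le_of_increment_le s0 tau0 C0 htau hC'.
(* Composition with z |-> t + z / 2 turns the linear coefficient m into (m - 2 s t) / 2, which is -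
   m / 2 for this t; condition (B) then applies with theta1 = 1 / 2. *)
pose t := m / s.
have st : s * t = m by rewrite /t mulrC divfK// gt_eqF.
have h2 : 0 < 2^-1 :> R by rewrite invr_gt0.
have gt z : gexp s m (t + 2^-1 * z) = gexp s m t * gexp (s / 4) (- (m / 2)) z.
  rewrite gexp_affine -[2 * s * t]mulrA st.
  have -> : s * 2^-1 ^+ 2 = s / 4 by field.
  by have -> : 2^-1 * (m - 2 * m) = - (m / 2) by field.
have /cvgr0Pnorm_le h0 : (F (t + 2^-1 * z) - F z) / gexp (s / 4) (- (m / 2)) z
    @[z --> +oo] --> (0 : R).
  apply: (@right_tail_gexp _ _ _ _ (2 * Num.max C 0 * gexp s m t)) => //; [lra|lra| |].
    by rewrite gt_eqF//; lra.
  (* Eventually t + z / 2 <= z, so the increment is at most 1 - F (t + z / 2), which [hS]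
     controls. *)
  near=> z.
  have tz : t + 2^-1 * z <= z.
    have : 2 * t <= z by near: z; apply: nbhs_pinfty_ge; exact: num_real.
    lra.
  have Fz := cumulative_le tz; have F1 := cumulative_le1 z.
  have : 1 - F (t + 2^-1 * z) <= 2 * Num.max C 0 * gexp s m (t + 2^-1 * z).
    by near: z; apply: (near_affine t h2 hS).
  rewrite gt; rewrite ler0_norm; lra.
apply/cvgr0Pnorm_le => e e0.
(* The limit [h0] is read along w |-> 2 w - 2 t, the inverse of z |-> t + z / 2: the increments
   there are at most e / 2 times the original Gaussian, and summing them doubles the constant. *)
have hS' : \forall z \near +oo, 1 - F z <= 2 * (e / 2) * gexp s m z.
  apply: (@tail_le_of_increment_le (fun w => - 2 * t + 2 * w) _ _ 1) => //; [lra| |].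
    near=> w.
    have : 2 * t + 1 <= w by near: w; apply: nbhs_pinfty_ge; exact: num_real.
    lra.
  have K0 : 0 < e / 2 * gexp s m t by rewrite mulr_gt0 ?gexp_gt0//; lra.
  have := h0 _ K0 => {}h0.
  have h22 : 0 < 2 :> R by [].
  have := near_affine (- 2 * t) h22 h0; apply: filterS => w /=.
  rewrite normrM normfV (gtr0_norm (gexp_gt0 _ _ _)) ler_pdivrMr ?gexp_gt0//.
  rewrite -(mulrA (e / 2)) -gt.
  rewrite (_ : t + 2^-1 * (- 2 * t + 2 * w) = w); last by field.
  by apply: le_trans; rewrite distrC ler_norm.
near=> z.
rewrite normrM normfV (gtr0_norm (gexp_gt0 _ _ _)) ler_pdivrMr ?gexp_gt0//.
rewrite ger0_norm; last by near: z.
have := cumulative_le1 (t0 + t1 * z).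
have : 1 - F z <= 2 * (e / 2) * gexp s m z by near: z.
lra.
Unshelve. all: by end_near. Qed.
End Tails.

(** * Mixtures over a common finite index type *)

Section FiniteMixtures.
Context {R : realType} (F : cumulativeBounded (0 : R) (1 : R)).
Hypothesis F_strict : {homo F : x y / x < y}.
Context {I : finType} (c s psi phi : I -> R).
Hypotheses (c_gt0 : forall i, 0 < c i) (psi_gt0 : forall i, 0 < psi i)
  (phi_gt0 : forall i, 0 < phi i).
Implicit Types (m kap w : I -> R) (a b : R).

Definition selection kap a b i y := F ((a * psi i + b * (y - kap i)) / phi i).

(** Weights may vanish, so two parameter sets with different components can share [I] and differ
    only in [w], [a], [b]. [m] and [kap] are arguments because the reflection y |-> - y negates
    them. *)
Definition weighted_mixture m kap w a b y :=
  \sum_i w i * c i * gexp (s i) (m i) y * selection kap a b i y.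

Definition dominates m i j := s i < s j \/ s i = s j /\ m j < m i.

Lemma selectionE kap a b i y : selection kap a b i y =
  F ((a * psi i - b * kap i) / phi i + b / phi i * y).
Proof.
have phi0 : phi i != 0 by rewrite gt_eqF.
by congr (F _); field.
Qed.

Lemma selection_gt0 kap a b i y : 0 < selection kap a b i y.
Proof. exact: (cumulative_gt0 F_strict). Qed.

Lemma selection_le1 kap a b i y : selection kap a b i y <= 1.
Proof. exact: (cumulative_le1 F_strict). Qed.

(** Both arguments of F have the same denominator, and their numerators differ by (a - a') psi + (b
    - b') (y - kap), which is eventually positive. *)
Lemma near_selection_lt kap a a' b b' : b' < b \/ b' = b /\ a' < a ->
  \forall y \near +oo, forall i, selection kap a' b' i y < selection kap a b i y.
Proof.
move=> ab; apply: filter_forall => i; near=> y.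
apply: F_strict; rewrite ltr_pM2r ?invr_gt0// -subr_gt0.
rewrite [ltRHS](_ : _ = (a - a') * psi i + (b - b') * (y - kap i)); last by ring.
case: ab => [bb|[-> aa]]; last by rewrite subrr mul0r addr0 mulr_gt0 ?subr_gt0.
have : ((a' - a) * psi i + 1) / (b - b') + kap i <= y.
  by near: y; apply: nbhs_pinfty_ge; exact: num_real.
rewrite -lerBrDr ler_pdivrMr ?subr_gt0//; lra.
Unshelve. all: by end_near. Qed.

Lemma weighted_mixtureN m kap w a b y : weighted_mixture m kap w a b (- y) =
  weighted_mixture (fun i => - m i) (fun i => - kap i) w a (- b) y.
Proof.
apply: eq_bigr => i _; rewrite gexpN; congr (_ * _ * F (_ / _)); ring.
Qed.

(** Only the i-th summand is kept; for b >= 0 its selection factor is nondecreasing in y, hence at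
    least its value at 0. *)
Lemma weighted_mixture_ge_term m kap w a b i y :
  (forall j, 0 <= w j) -> 0 <= b -> 0 <= y ->
  w i * c i * selection kap a b i 0 <=
    weighted_mixture m kap w a b y / gexp (s i) (m i) y.
Proof.
move=> w0 b0 y0; rewrite ler_pdivlMr ?gexp_gt0//.
rewrite /weighted_mixture (bigD1 i)//= -[leLHS]addr0; apply: lerD; last first.
  apply: sumr_ge0 => j _.
  by rewrite !mulr_ge0 ?(ltW (c_gt0 _))// ltW// ?gexp_gt0 ?selection_gt0.
rewrite mulrAC; apply: ler_wpM2l.
  by rewrite !mulr_ge0 ?(ltW (c_gt0 _))// ltW// gexp_gt0.
apply: (cumulative_le F_strict); rewrite ler_pM2r ?invr_gt0//.
by rewrite lerD2l; apply: ler_wpM2l => //; lra.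
Qed.

Lemma cvg_sumr (f : I -> R -> R) (l : I -> R) :
  (forall i, f i y @[y --> +oo] --> l i) ->
  \sum_i f i y @[y --> +oo] --> \sum_i l i.
Proof. by move=> fl; apply: cvg_big => //; exact: add_continuous. Qed.

Lemma dominates_cvg0 m i j : dominates m i j ->
  gexp (s j) (m j) y / gexp (s i) (m i) y @[y --> +oo] --> (0 : R).
Proof.
move=> ij; under eq_cvg do rewrite gexp_div.
by apply: gexp_cvg0; case: ij => [?|[-> ?]]; [left|right; split]; lra.
Qed.

Lemma cvg0_mul_bounded (f g : R -> R) (C : R) : f y @[y --> +oo] --> (0 : R) ->
  (forall y, `|g y| <= C) -> f y * g y @[y --> +oo] --> (0 : R).
Proof.
move=> f0 gC; apply/cvgr0Pnorm_le => e e0.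
have C0 : 0 < `|C| + 1 by have := normr_ge0 C; lra.
near=> y; rewrite normrM.
have : `|f y| <= e / (`|C| + 1).
  by near: y; apply: (cvgr0_norm_le _ f0); rewrite divr_gt0.
rewrite ler_pdivlMr//; apply: le_trans; apply: ler_wpM2l => //.
by apply: (le_trans (gC y)); have := ler_norm C; lra.
Unshelve. all: by end_near. Qed.

(** Lexicographic choice: minimise [s], then maximise [m] among the minimisers; injectivity makes
    the domination strict. *)
Lemma dominant_exists m (P : pred I) i1 : injective (fun i => (s i, m i)) -> P i1 ->
  exists2 i, P i & forall j, P j -> j != i -> dominates m i j.
Proof.
move=> sm_inj Pi1; case: (arg_minP s Pi1) => i2 Pi2 si2.
have Qi2 : P i2 && (s i2 == s i2) by rewrite Pi2 eqxx.
case: (@arg_maxP _ _ _ i2 (fun j => P j && (s j == s i2)) m Qi2) => i /andP[Pi /eqP si] mi.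
exists i => // j Pj ji; have := si2 j Pj; rewrite /= le_eqVlt => /predU1P[sj|sj]; last first.
  by left; rewrite si.
right; rewrite si sj; split => //.
have := mi j; rewrite Pj -sj eqxx => /(_ isT) /=; rewrite le_eqVlt => /predU1P[mj|//].
by case/eqP: ji; apply: sm_inj; rewrite mj si sj.
Qed.

Lemma dominates_total m i j : injective (fun i => (s i, m i)) -> i != j ->
  dominates m i j \/ dominates m j i.
Proof.
move=> sm_inj ij; case: (ltgtP (s i) (s j)) => sij; [by left; left|by right; left|].
case: (ltgtP (m i) (m j)) => mij; [by right; right|by left; right|].
by case/eqP: ij; apply: sm_inj; rewrite sij mij.
Qed.

(** Divided by the dominant term among those with nonzero coefficient, the vanishing sum tends to
    that coefficient. *)
Lemma gexp_family_free m (e : I -> R) : injective (fun i => (s i, m i)) ->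
  (forall y, \sum_i e i * gexp (s i) (m i) y = 0) -> forall i, e i = 0.
Proof.
move=> sm_inj e0 i1; apply/eqP/negPn/negP => ei1.
have [i ei idom] := @dominant_exists m (fun i => e i != 0) i1 sm_inj ei1.
have : \sum_j e j * (gexp (s j) (m j) y / gexp (s i) (m i) y) @[y --> +oo] -->
    \sum_j (if j == i then e i else 0).
  apply: cvg_sumr => j; case: eqVneq => [->|ji].
    under eq_cvg do rewrite divff ?gexp_neq0// mulr1.
    exact: cvg_cst.
  have [->|ej] := eqVneq (e j) 0.
    under eq_cvg do rewrite mul0r.
    exact: cvg_cst.
  by rewrite -(mulr0 (e j)); apply: cvgM; [exact: cvg_cst|exact/dominates_cvg0/idom].
rewrite -big_mkcond big_pred1_eq.
have -> : (fun y => \sum_j e j * (gexp (s j) (m j) y / gexp (s i) (m i) y)) =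
    (fun=> 0).
  apply/funext => y.
  transitivity ((\sum_j e j * gexp (s j) (m j) y) / gexp (s i) (m i) y); last first.
    by rewrite e0 mul0r.
  by rewrite mulr_suml; apply: eq_bigr => j _; rewrite mulrA.
move=> /(cvg_unique (@Rhausdorff R) (cvg_cst 0)) /eqP.
by rewrite eq_sym (negPf ei).
Qed.

(** * Identifiability over a common index type *)

Hypothesis condA : left_tail_condition F.
Hypothesis condB : right_tail_condition F.

(** The substitution z = u' + r' y reduces this to [increment_cvg0]; [K], [sg'] and [mu'] describe
    the Gaussian in the variable z. *)
Lemma increment_affine_cvg0 (u r u' r' sg mu C : R) : 0 < r' ->
    r' < r \/ r' = r /\ u' <= u -> 0 < sg \/ sg = 0 /\ mu < 0 ->
    (\forall y \near +oo, F (u + r * y) - F (u' + r' * y) <= C * gexp sg mu y) ->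
  (F (u + r * y) - F (u' + r' * y)) / gexp sg mu y @[y --> +oo] --> (0 : R).
Proof.
move=> r'0 ur sm hC.
have r'N0 : r' != 0 by rewrite gt_eqF.
have [[ru uu]|neq] := pselect (r' = r /\ u' = u).
  rewrite ru uu; under eq_cvg do rewrite subrr mul0r.
  exact: cvg_cst.
pose t1 := r / r'; pose t0 := u - t1 * u'.
have Lz y : t0 + t1 * (u' + r' * y) = u + r * y by rewrite /t0 /t1; field.
have tt : 1 < t1 \/ t1 = 1 /\ 0 < t0.
  rewrite /t0 /t1; case: ur => [rr|[rr uu]]; first by left; rewrite ltr_pdivlMr ?mul1r.
  right; rewrite -rr divff// mul1r subr_gt0; split => //.
  by rewrite lt_neqAle uu andbT; apply/eqP => uE; apply: neq.
pose K := gexp sg mu (- u' / r').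
pose sg' := sg * r'^-1 ^+ 2; pose mu' := r'^-1 * (mu - 2 * sg * (- u' / r')).
have gK z : gexp sg mu (- u' / r' + r'^-1 * z) = K * gexp sg' mu' z.
  exact: gexp_affine.
have yz z : u' + r' * (- u' / r' + r'^-1 * z) = z by field.
have zy y : - u' / r' + r'^-1 * (u' + r' * y) = y by field.
have sm' : 0 < sg' \/ sg' = 0 /\ mu' < 0.
  rewrite /sg' /mu'; case: sm => [?|[-> ?]].
    by left; rewrite mulr_gt0// exprn_gt0// invr_gt0.
  right; rewrite mul0r mulr0 mul0r subr0; split => //.
  by rewrite pmulr_rlt0// invr_gt0.
have hC' : \forall z \near +oo, F (t0 + t1 * z) - F z <= C * K * gexp sg' mu' z.
  have r'V : 0 < r'^-1 by rewrite invr_gt0.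
  have := near_affine (- u' / r') r'V hC; apply: filterS => z.
  by rewrite -Lz yz gK mulrA.
have h0 := increment_cvg0 F_strict condB tt sm' hC'.
have := cvg_comp _ (fun z => (F (t0 + t1 * z) - F z) / gexp sg' mu' z)
  (cvgy_affine u' r'0) h0.
have K0 : K != 0 by rewrite gexp_neq0.
move=> /(cvgM (cvg_cst K^-1)); rewrite mulr0; apply: cvg_trans.
apply: near_eq_cvg; near=> y => /=.
rewrite (_ : gexp sg mu y = K * gexp sg' mu' (u' + r' * y)); last by rewrite -gK zy.
by rewrite Lz invfM mulrCA.
Unshelve. all: by end_near. Qed.

(** With z = u + r y tending to -oo, exp (d y) is a constant times exp (- dl z) for dl = - d / r >
    0. Condition (A) leaves 0 or +oo, and the bound excludes +oo. *)
Lemma left_tail_cvg0 (u r d C : R) : r < 0 -> 0 < d ->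
    (\forall y \near +oo, F (u + r * y) * gexp 0 d y <= C) ->
  F (u + r * y) * gexp 0 d y @[y --> +oo] --> (0 : R).
Proof.
move=> r0 d0 hC; have rN0 : r != 0 by rewrite lt_eqF.
pose dl := - d / r.
have dl0 : 0 < dl by rewrite /dl mulNr -mulrN -invrN divr_gt0// oppr_gt0.
pose K := expR (dl * u).
have quotE y : F (u + r * y) * gexp 0 d y = K * (F (u + r * y) / expR (dl * (u + r * y))).
  rewrite mulrCA; congr (_ * _); rewrite /K -expRN -expRD; congr expR.
  by rewrite /dl; field.
have F0 y : 0 <= F y by rewrite ltW// cumulative_gt0.
apply: (@cvg0_of_dichotomy _ _ C); last first.
  apply: filterS hC => y; rewrite ger0_norm// mulr_ge0//.
  by rewrite ltW// gexp_gt0.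
have K0 : 0 < K by exact: expR_gt0.
pose q z := F z / expR (dl * z).
case: (condA dl0) => hA; [left|right].
  under eq_cvg do rewrite quotE.
  have := cvgM (cvg_cst K) (cvg_comp _ q (cvgNy_affine u r0) hA).
  by rewrite mulr0; exact.
have -> : (fun y => `|F (u + r * y) * gexp 0 d y|) = (fun y => K * q (u + r * y)).
  apply/funext => y; rewrite ger0_norm; first exact: quotE.
  by rewrite mulr_ge0// ltW// gexp_gt0.
exact: (gt0_cvgMry K0 (cvg_comp _ q (cvgNy_affine u r0) hA)).
Qed.

Lemma exists_weight_gt0 w : (forall i, 0 <= w i) -> \sum_i w i = 1 ->
  exists i, 0 < w i.
Proof.
move=> w0 w1; have [|i /= wi] := @psumr_neq0P _ _ predT w (fun i _ => w0 i).
  by rewrite w1; apply/eqP; rewrite oner_eq0.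
by exists i.
Qed.

Lemma weights_eq m kap wp wq a a' b b' : injective (fun i => (s i, m i)) ->
    (forall i, 0 <= wp i) -> 0 < b -> 0 < b' ->
    b' < b \/ b' = b /\ a' <= a ->
    (forall y, weighted_mixture m kap wp a b y = weighted_mixture m kap wq a' b' y) ->
  forall i, wp i = wq i.
Proof.
move=> sm_inj wp0 b0 b'0 ab obs i1; apply/eqP/negPn/negP => wi1.
have [i wi idom] := @dominant_exists m (fun i => wp i != wq i) i1 sm_inj wi1.
pose g j y := gexp (s j) (m j) y / gexp (s i) (m i) y.
have g0 j y : 0 <= g j y by rewrite divr_ge0// ltW// gexp_gt0.
pose D j y := selection kap a b j y - selection kap a' b' j y.
(* [T] collects the indices with equal weights, [U] the others, all divided by the Gaussian of [i].
   In [U] every index other than [i] is dominated by [i], so its sum converges; hence so does that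
   of [T]. *)
pose T j y := if wp j == wq j then wp j * c j * (g j y * D j y) else 0.
pose U j y := if wp j == wq j then 0 else
  c j * (g j y * (wp j * selection kap a b j y - wq j * selection kap a' b' j y)).
have TU y : \sum_j T j y = - \sum_j U j y.
  apply/eqP; rewrite -addr_eq0 -big_split/=.
  have /eqP := obs y; rewrite -subr_eq0 -sumrB => /eqP obsy.
  apply/eqP; transitivity ((\sum_j (wp j * c j * gexp (s j) (m j) y * selection kap a b j y -
      wq j * c j * gexp (s j) (m j) y * selection kap a' b' j y)) / gexp (s i) (m i) y).
    rewrite mulr_suml; apply: eq_bigr => j _; rewrite /T /U /D /g.
    by case: eqVneq => [->|_]; ring.
  by rewrite obsy mul0r.
have sel1 j : selection kap a b j y @[y --> +oo] --> (1 : R).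
  under eq_cvg do rewrite selectionE.
  by apply: cumulative_cvg1; rewrite divr_gt0.
have sel1' j : selection kap a' b' j y @[y --> +oo] --> (1 : R).
  under eq_cvg do rewrite selectionE.
  by apply: cumulative_cvg1; rewrite divr_gt0.
have Ucvg : \sum_j U j y @[y --> +oo] --> \sum_j (if j == i then c i * (wp i - wq i) else 0).
  apply: cvg_sumr => j; rewrite /U; case: (eqVneq (wp j) (wq j)) => wj.
    have [ji|ji] := eqVneq j i; first by move: wi; rewrite -ji wj eqxx.
    exact: cvg_cst.
  have -> : (if j == i then c i * (wp i - wq i) else 0) =
      c j * ((if j == i then 1 else 0) * (wp j * 1 - wq j * 1)).
    by case: eqVneq => [->|_]; rewrite ?mul0r ?mulr0 // !mulr1 ?mul1r.
  apply: cvgM; first exact: cvg_cst.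
  apply: cvgM; last by apply: cvgB; apply: cvgM => //; exact: cvg_cst.
  case: eqVneq => [->|ji].
    by under eq_cvg do rewrite /g divff ?gexp_neq0//; exact: cvg_cst.
  exact/dominates_cvg0/idom.
rewrite -big_mkcond big_pred1_eq in Ucvg.
have Tcvg : \sum_j T j y @[y --> +oo] --> - (c i * (wp i - wq i)).
  under eq_cvg do rewrite TU.
  exact: cvgN.
have D0 : \forall y \near +oo, forall j, 0 <= D j y.
  have [lt_ab|eq_ab] : (b' < b \/ b' = b /\ a' < a) \/ (b' = b /\ a' = a).
    case: ab => [?|[-> ]]; first by left; left.
    by rewrite le_eqVlt => /predU1P[->|?]; [right|left; right].
  - apply: filterS (near_selection_lt kap lt_ab) => y h j.
    by rewrite subr_ge0 ltW.
  - by have [bE aE] := eq_ab; near=> y => j; rewrite /D bE aE subrr.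
have T0 : \forall y \near +oo, forall j, 0 <= T j y.
  apply: filterS D0 => y h j; rewrite /T; case: ifP => // _.
  by apply: mulr_ge0; apply: mulr_ge0; [exact: wp0|exact/ltW|exact: g0|exact: h].
pose C := `|- (c i * (wp i - wq i))| + 1.
have TC : \forall y \near +oo, forall j, T j y <= C.
  have h : \forall y \near +oo, \sum_j T j y <= C.
    apply: (cvgr_le _ Tcvg); rewrite /C.
    by rewrite (le_lt_trans (ler_norm _))// ltrDl.
  near=> y => j; apply: (@le_trans _ _ (\sum_j T j y)); last by near: y.
  have Ty : forall j, 0 <= T j y by near: y.
  by rewrite (bigD1 j)//= lerDl sumr_ge0.
have Tj j : T j y @[y --> +oo] --> (0 : R).
  have [wj|wj] := eqVneq (wp j) (wq j); last first.
    by rewrite /T (negPf wj); exact: cvg_cst.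
  have [wj0|wj0] := eqVneq (wp j) 0.
    rewrite /T wj0; under eq_cvg do rewrite !mul0r if_same.
    exact: cvg_cst.
  have ij : i != j by apply: contraNneq wi => ->; apply/eqP.
  have Tw : T j = (fun y => wp j * c j * (g j y * D j y)).
    by apply/funext => y; rewrite /T wj eqxx.
  have wc0 : 0 < wp j * c j by rewrite mulr_gt0// lt0r wj0 wp0.
  rewrite Tw -(mulr0 (wp j * c j)); apply: cvgM; first exact: cvg_cst.
  (* If [i] dominates [j], the Gaussian ratio vanishes and [D j] is bounded. Otherwise the ratio is
     the inverse of a decaying Gaussian, so the bound on [T j] is the increment bound required by
     [increment_affine_cvg0]. *)
  have [dom|dom] := dominates_total sm_inj ij.
    apply: (@cvg0_mul_bounded _ _ 1); first exact: dominates_cvg0.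
    move=> y; rewrite /D ler_norml.
    have := selection_gt0 kap a b j y; have := selection_gt0 kap a' b' j y.
    have := selection_le1 kap a b j y; have := selection_le1 kap a' b' j y.
    by move=> *; apply/andP; split; lra.
  rewrite /g /D.
  have gE y : gexp (s j) (m j) y / gexp (s i) (m i) y =
      (gexp (s i - s j) (m i - m j) y)^-1.
    by rewrite -gexp_div invf_div.
  under eq_cvg do rewrite gE mulrC !selectionE.
  apply: (@increment_affine_cvg0 _ _ _ _ _ _ (C / (wp j * c j))).
  - by rewrite divr_gt0.
  - case: ab => [bb|[-> aa]]; [left|right]; first by rewrite ltr_pM2r// invr_gt0.
    by split => //; rewrite ler_pM2r ?invr_gt0// lerD2r ler_pM2r.
  - by case: dom => [?|[-> ?]]; [left|right]; rewrite ?subrr ?subr_gt0 ?subr_lt0.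
  - near=> y.
    have : forall j, T j y <= C by near: y.
    move=> /(_ j); rewrite Tw /g gE /D !selectionE.
    rewrite -ler_pdivlMl// ler_pdivrMl ?gexp_gt0// => h.
    by rewrite [leRHS]mulrC [C / _]mulrC.
have := cvg_sumr Tj; rewrite big1// => T0cvg.
have /eqP : - (c i * (wp i - wq i)) = 0 by exact: (cvg_unique (@Rhausdorff R) Tcvg T0cvg).
rewrite oppr_eq0 mulf_eq0 subr_eq0 (negPf wi) orbF.
by rewrite gt_eqF.
Unshelve. all: by end_near. Qed.

(** Once the weights agree, distinct (a, b) would order all selection factors strictly for large y;
    a positive weight then makes the two mixtures differ. *)
Lemma params_eq_of_le m kap wp wq a a' b b' : injective (fun i => (s i, m i)) ->
    (forall i, 0 <= wp i) -> \sum_i wp i = 1 -> 0 < b -> 0 < b' ->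
    b' < b \/ b' = b /\ a' <= a ->
    (forall y, weighted_mixture m kap wp a b y = weighted_mixture m kap wq a' b' y) ->
  [/\ forall i, wp i = wq i, a = a' & b = b'].
Proof.
move=> sm_inj wp0 wp1 b0 b'0 ab obs.
have wpq := weights_eq sm_inj wp0 b0 b'0 ab obs.
have [lt_ab|[-> ->]//] : (b' < b \/ b' = b /\ a' < a) \/ (b = b' /\ a = a').
  case: ab => [?|[-> ]]; first by left; left.
  by rewrite le_eqVlt => /predU1P[->|?]; [right|left; right].
exfalso; have [i wi] := exists_weight_gt0 wp0 wp1.
near (pinfty_nbhs R) => y.
have sel : forall j, selection kap a' b' j y < selection kap a b j y.
  by near: y; exact: near_selection_lt.
suff : weighted_mixture m kap wq a' b' y < weighted_mixture m kap wp a b y.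
  by rewrite obs ltxx.
rewrite /weighted_mixture (bigD1 i)//= [ltRHS](bigD1 i)//=; apply: ltr_leD.
  by rewrite -wpq ltr_pM2l// !mulr_gt0// gexp_gt0.
apply: ler_sum => j _; rewrite -wpq; apply: ler_wpM2l; last exact: ltW.
by apply: mulr_ge0; [apply: mulr_ge0|]; rewrite // ltW// gexp_gt0.
Unshelve. all: by end_near. Qed.

Lemma params_eq_pos m kap wp wq a a' b b' : injective (fun i => (s i, m i)) ->
    (forall i, 0 <= wp i) -> \sum_i wp i = 1 ->
    (forall i, 0 <= wq i) -> \sum_i wq i = 1 -> 0 < b -> 0 < b' ->
    (forall y, weighted_mixture m kap wp a b y = weighted_mixture m kap wq a' b' y) ->
  [/\ forall i, wp i = wq i, a = a' & b = b'].
Proof.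
move=> sm_inj wp0 wp1 wq0 wq1 b0 b'0 obs.
have [ab|ab] : (b' < b \/ b' = b /\ a' <= a) \/ (b < b' \/ b = b' /\ a <= a').
  case: (ltgtP b' b) => bb; [by left; left|by right; left|].
  by case: (leP a' a) => aa; [left|right]; right; split => //; exact: ltW.
- exact: (params_eq_of_le sm_inj wp0 wp1 b0 b'0 ab obs).
- have := params_eq_of_le sm_inj wq0 wq1 b'0 b0 ab (fun y => esym (obs y)).
  by case=> wE aE bE; split.
Qed.

(** For b = 0 selection is constant in y, so linear independence equates the products of weight and
    selection. As a' <= a, this forces wp <= wq pointwise, and equal totals give equality. *)
Lemma params_eq0 m kap wp wq a a' : injective (fun i => (s i, m i)) ->
    (forall i, 0 <= wp i) -> \sum_i wp i = 1 ->
    (forall i, 0 <= wq i) -> \sum_i wq i = 1 -> a' <= a ->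
    (forall y, weighted_mixture m kap wp a 0 y = weighted_mixture m kap wq a' 0 y) ->
  (forall i, wp i = wq i) /\ a = a'.
Proof.
move=> sm_inj wp0 wp1 wq0 wq1 aa obs.
pose sel (x : R) i := F (x * psi i / phi i).
have selE x i y : selection kap x 0 i y = sel x i by rewrite /selection mul0r addr0.
have wE i : wp i * sel a i = wq i * sel a' i.
  have := @gexp_family_free m (fun i => c i * (wp i * sel a i - wq i * sel a' i)) sm_inj.
  move=> /(_ _ i)/eqP; rewrite mulf_eq0 (gt_eqF (c_gt0 i)) subr_eq0 => h; apply/eqP/h.
  move=> y; have /eqP := obs y; rewrite -subr_eq0 -sumrB => /eqP obsy.
  by rewrite -[RHS]obsy; apply: eq_bigr => j _; rewrite !selE; ring.
have sel0 x i : 0 < sel x i by exact: (cumulative_gt0 F_strict).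
have sel_le i : sel a' i <= sel a i.
  by apply: (cumulative_le F_strict); rewrite ler_pM2r ?invr_gt0// ler_pM2r.
have wle i : 0 <= wq i - wp i.
  rewrite subr_ge0 -(ler_pM2r (sel0 a i)) wE; exact: ler_wpM2l.
have weq i : wp i = wq i.
  have : \sum_i (wq i - wp i) = 0 by rewrite sumrB wq1 wp1 subrr.
  by move=> /psumr_eq0P => /(_ (fun i _ => wle i) i isT)/eqP; rewrite subr_eq0 => /eqP.
split=> //; have [i wi] := exists_weight_gt0 wp0 wp1.
have := wE i; rewrite -weq => /(mulfI (lt0r_neq0 wi)) selaE.
apply/eqP; rewrite eq_le aa andbT leNgt; apply/negP => lt_aa.
suff : sel a' i < sel a i by rewrite selaE ltxx.
by apply: F_strict; rewrite ltr_pM2r ?invr_gt0// ltr_pM2r.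
Qed.

(** Otherwise, after division by the widest Gaussian with positive [wp], the right side tends to 0
    while the left stays above a positive constant. *)
Lemma widest_component_le m kap wp wq a a' b b' :
    (forall i, 0 <= wp i) -> \sum_i wp i = 1 -> (forall i, 0 <= wq i) -> 0 <= b ->
    (forall y, weighted_mixture m kap wp a b y = weighted_mixture m kap wq a' b' y) ->
  exists2 j, 0 < wq j & forall i, 0 < wp i -> s j <= s i.
Proof.
move=> wp0 wp1 wq0 b0 obs; have [i1 wi1] := exists_weight_gt0 wp0 wp1.
case: (@arg_minP _ _ _ i1 (fun i => 0 < wp i) s wi1) => i wi imin.
have [[j wj ji]|no_j] := pselect (exists2 j, 0 < wq j & s j <= s i).
  by exists j => // k wk; apply: (le_trans ji); exact: imin.
have lb : \forall y \near +oo, wp i * c i * selection kap a b i 0 <=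
    \sum_j wq j * c j * (gexp (s j) (m j) y / gexp (s i) (m i) y *
      selection kap a' b' j y).
  near=> y; have y0 : 0 <= y by near: y; apply: nbhs_pinfty_ge; exact: num_real.
  apply: (le_trans (weighted_mixture_ge_term m kap a i wp0 b0 y0)).
  rewrite obs mulr_suml le_eqVlt; apply/orP; left; apply/eqP.
  by apply: eq_bigr => j _; ring.
have ub : \sum_j wq j * c j * (gexp (s j) (m j) y / gexp (s i) (m i) y *
    selection kap a' b' j y) @[y --> +oo] --> \sum_(j : I) (0 : R).
  apply: cvg_sumr => j; have [wj|wj] := eqVneq (wq j) 0.
    under eq_cvg do rewrite wj !mul0r.
    exact: cvg_cst.
  have sij : s i < s j.
    by rewrite ltNge; apply/negP => sji; apply: no_j; exists j; rewrite // lt0r wj wq0.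
  have := cvgM (cvg_cst (wq j * c j)) (@cvg0_mul_bounded _ (selection kap a' b' j) 1
    (dominates_cvg0 (or_introl sij)) _).
  rewrite mulr0; apply => y.
  by rewrite ger0_norm ?selection_le1// ltW// selection_gt0.
exfalso; rewrite big1// in ub.
have : wp i * c i * selection kap a b i 0 <= 0 by exact: (cvgr_to_ge ub lb).
rewrite leNgt => /negP; apply.
by apply: mulr_gt0; [exact: mulr_gt0|exact: selection_gt0].
Unshelve. all: by end_near. Qed.

(** Divide by the dominant Gaussian with positive [wq]: the right side stays bounded and above a
    positive constant, while every term of the left side tends to 0. *)
Lemma opposite_tails_false m kap wp wq a a' b b' : injective (fun i => (s i, m i)) ->
    (forall i, 0 <= wp i) -> (forall i, 0 <= wq i) -> b < 0 -> 0 <= b' ->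
    (exists2 j, 0 < wq j & forall i, 0 < wp i -> s j <= s i) ->
    (forall y, weighted_mixture m kap wp a b y = weighted_mixture m kap wq a' b' y) ->
  False.
Proof.
move=> sm_inj wp0 wq0 b0 b'0 [j1 wj1 j1min] obs.
have [j wj jdom] := @dominant_exists m (fun i => 0 < wq i) j1 sm_inj wj1.
have jmin i : 0 < wp i -> s j <= s i.
  move=> /j1min; apply: le_trans; have [->//|j1j] := eqVneq j1 j.
  by case: (jdom _ wj1 j1j) => [/ltW//|[->]].
pose g i y := gexp (s i) (m i) y / gexp (s j) (m j) y.
have g0 i y : 0 <= g i y by rewrite divr_ge0// ltW// gexp_gt0.
pose T i y := wp i * c i * (g i y * selection kap a b i y).
have TE y : \sum_i T i y = weighted_mixture m kap wq a' b' y / gexp (s j) (m j) y.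
  by rewrite -obs mulr_suml; apply: eq_bigr => i _; rewrite /T /g; ring.
have TE' y : \sum_i T i y = \sum_i wq i * c i * (g i y * selection kap a' b' i y).
  by rewrite TE mulr_suml; apply: eq_bigr => i _; rewrite /g; ring.
have T0 i y : 0 <= T i y.
  apply: mulr_ge0; apply: mulr_ge0; rewrite ?wp0 ?g0//; apply: ltW => //.
  exact: selection_gt0.
pose C : R := (\sum_i (if i == j then wq j * c j else 0)) + 1.
have TC : \forall y \near +oo, forall i, T i y <= C.
  have h : \sum_i wq i * c i * g i y @[y --> +oo] -->
      \sum_i (if i == j then wq j * c j else 0).
    apply: cvg_sumr => i; have [->|ij] := eqVneq i j.
      under eq_cvg do rewrite /g divff ?gexp_neq0// mulr1.
      exact: cvg_cst.
    have [wi|wi] := eqVneq (wq i) 0.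
      under eq_cvg do rewrite wi !mul0r.
      exact: cvg_cst.
    have wi0 : 0 < wq i by rewrite lt0r wi wq0.
    have := cvgM (cvg_cst (wq i * c i)) (dominates_cvg0 (jdom _ wi0 ij)).
    by rewrite mulr0; exact.
  have h' : \forall y \near +oo, \sum_i wq i * c i * g i y <= C.
    by apply: (cvgr_le _ h); rewrite /C ltrDl.
  apply: filterS h' => y Cy i; apply: (@le_trans _ _ (\sum_i T i y)).
    by rewrite (bigD1 i)//= lerDl sumr_ge0.
  apply: le_trans Cy; rewrite TE'; apply: ler_sum => k _; apply: ler_wpM2l.
    by rewrite mulr_ge0// ltW.
  by rewrite -[leRHS]mulr1; apply: ler_wpM2l => //; exact: selection_le1.
have selnorm i y : `|selection kap a b i y| <= 1.
  by rewrite ger0_norm ?selection_le1// ltW// selection_gt0.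
have Tcvg i : T i y @[y --> +oo] --> (0 : R).
  have [wi|wi] := eqVneq (wp i) 0.
    under eq_cvg do rewrite /T wi !mul0r.
    exact: cvg_cst.
  have wi0 : 0 < wp i by rewrite lt0r wi wp0.
  have wc0 : 0 < wp i * c i by rewrite mulr_gt0.
  suff h : g i y * selection kap a b i y @[y --> +oo] --> (0 : R).
    by have := cvgM (cvg_cst (wp i * c i)) h; rewrite mulr0; exact.
  have := jmin i wi0; rewrite le_eqVlt => /predU1P[sij|sij]; last first.
    by apply: (@cvg0_mul_bounded _ _ 1) => //; apply: dominates_cvg0; left.
  have gE y : g i y = gexp 0 (m i - m j) y by rewrite /g gexp_div sij subrr.
  have bphi : b / phi i < 0 by rewrite pmulr_llt0// invr_gt0.
  have sel_cvg : selection kap a b i y @[y --> +oo] --> (0 : R).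
    under eq_cvg do rewrite selectionE.
    exact: cumulative_cvg0.
  (* At equal variance: a smaller [m i] is dominated; for a larger one the bound [TC] calls on
     condition (A); for equal ones only the selection factor remains, which vanishes since b < 0. *)
  case: (ltgtP (m i) (m j)) => mij.
  - apply: (@cvg0_mul_bounded _ _ 1) => //.
    by apply: dominates_cvg0; right.
  - under eq_cvg do rewrite gE mulrC selectionE.
    apply: (@left_tail_cvg0 _ _ _ (C / (wp i * c i))) => //; first by rewrite subr_gt0.
    apply: filterS TC => y /(_ i).
    rewrite /T gE selectionE -(ler_pdivlMl _ _ wc0) => h.
    by rewrite [leRHS]mulrC [leLHS]mulrC.
  - under eq_cvg do rewrite gE mij subrr /gexp oppr0 !mul0r addr0 expR0 mul1r.
    exact: sel_cvg.
have ub := cvg_sumr Tcvg; rewrite big1// in ub.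
have lb : \forall y \near +oo, wq j * c j * selection kap a' b' j 0 <= \sum_i T i y.
  near=> y; have y0 : 0 <= y by near: y; apply: nbhs_pinfty_ge; exact: num_real.
  by rewrite TE; exact: weighted_mixture_ge_term.
have : wq j * c j * selection kap a' b' j 0 <= 0 by exact: (cvgr_to_ge ub lb).
rewrite leNgt => /negP; apply.
by apply: mulr_gt0; [exact: mulr_gt0|exact: selection_gt0].
Unshelve. all: by end_near. Qed.

(** The comparison of widths is made at +oo, where b > 0. The reflection keeps [s], so it remains
    available at the other end, where the slope - b is negative. *)
Lemma opposite_signs_false m kap wp wq a a' b b' : injective (fun i => (s i, m i)) ->
    (forall i, 0 <= wp i) -> \sum_i wp i = 1 -> (forall i, 0 <= wq i) ->
    0 < b -> b' <= 0 ->
    (forall y, weighted_mixture m kap wp a b y = weighted_mixture m kap wq a' b' y) ->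
  False.
Proof.
move=> sm_inj wp0 wp1 wq0 b0 b'0 obs.
have widest := widest_component_le wp0 wp1 wq0 (ltW b0) obs.
apply: (@opposite_tails_false (fun i => - m i) (fun i => - kap i)
  wp wq a a' (- b) (- b')) => //.
- by move=> i j /= [sij mij]; apply: sm_inj; rewrite sij (oppr_inj mij).
- by rewrite oppr_lt0.
- by rewrite oppr_ge0.
- by move=> y; rewrite -!weighted_mixtureN obs.
Qed.

Lemma weighted_mixture_identifiable m kap wp wq a a' b b' :
    injective (fun i => (s i, m i)) ->
    (forall i, 0 <= wp i) -> \sum_i wp i = 1 ->
    (forall i, 0 <= wq i) -> \sum_i wq i = 1 ->
    (forall y, weighted_mixture m kap wp a b y = weighted_mixture m kap wq a' b' y) ->
  [/\ forall i, wp i = wq i, a = a' & b = b'].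
Proof.
move=> sm_inj wp0 wp1 wq0 wq1.
(* Quantified over [m] and [kap] so that the reflection, which changes both, can be applied. *)
pose claim x x' := forall m kap, injective (fun i => (s i, m i)) ->
  (forall y, weighted_mixture m kap wp a x y = weighted_mixture m kap wq a' x' y) ->
  [/\ forall i, wp i = wq i, a = a' & x = x'].
have neg_inj (n : I -> R) : injective (fun i => (s i, n i)) -> injective (fun i => (s i, - n i)).
  by move=> sn_inj i j /= [sij nij]; apply: sn_inj; rewrite sij (oppr_inj nij).
have reflect x x' : claim (- x) (- x') -> claim x x'.
  move=> cl n k sn_inj obs.
  have [|wE aE /oppr_inj xE] := cl (fun i => - n i) (fun i => - k i) (neg_inj _ sn_inj).
    by move=> y; rewrite -!weighted_mixtureN obs.
  by split.
suff : claim b b' by move=> cl sm_obs; exact: (cl m kap).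
have pos_claim x x' : 0 < x -> claim x x'.
  move=> x0 n k sn_inj obs; have [x'0|x'0] := ltP 0 x'.
    exact: (params_eq_pos sn_inj wp0 wp1 wq0 wq1 x0 x'0 obs).
  by have := opposite_signs_false sn_inj wp0 wp1 wq0 x0 x'0 obs.
have pos_claim' x x' : 0 < x' -> claim x x'.
  move=> x'0 n k sn_inj obs; have [x0|x0] := ltP 0 x.
    exact: (params_eq_pos sn_inj wp0 wp1 wq0 wq1 x0 x'0 obs).
  by have := opposite_signs_false sn_inj wq0 wq1 wp0 x'0 x0 (fun y => esym (obs y)).
case: (ltgtP b 0) => b0; [|exact: pos_claim|].
  by apply: reflect; apply: pos_claim; rewrite oppr_gt0.
case: (ltgtP b' 0) => b'0; [|exact: pos_claim'|].
  by apply: reflect; apply: pos_claim'; rewrite oppr_gt0.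
rewrite b0 b'0 => n k sn_inj obs; have [aa|/ltW aa] := leP a' a.
  by have [] := params_eq0 sn_inj wp0 wp1 wq0 wq1 aa obs.
have [wE aE] := params_eq0 sn_inj wq0 wq1 wp0 wp1 aa (fun y => esym (obs y)).
by split.
Qed.

End FiniteMixtures.

(** * From parameter sets to weights on a common index type *)

Lemma normal_pdf_gexp (R : realType) (mu v y : R) : 0 < v ->
  normal_pdf 0 1 ((y - mu) / Num.sqrt v) =
    normal_peak 1 * expR (- (mu ^+ 2 / (2 * v))) * gexp (2 * v)^-1 (mu / v) y.
Proof.
move=> v0; have vN0 : v != 0 by rewrite gt_eqF.
rewrite /normal_pdf oner_eq0 /= /normal_fun -mulrA; congr (_ * _).
rewrite /gexp -expRD; congr expR.
by rewrite subr0 expr_div_n sqr_sqrtr ?(ltW v0)// expr1n -mulr_natr; field.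
Qed.

Section Regrouping.
Context {R : realType} {I : finType}.
Implicit Types p q : mixture_params R.

(** The push-forward of the weights along [f]: an index outside the image of [f] gets weight 0. *)
Definition regrouped p (f : 'I_(ncomp p) -> I) (i : I) : R :=
  \sum_(k | f k == i) weight k.

Lemma sum_regrouped p (f : 'I_(ncomp p) -> I) (h : I -> R) :
  \sum_k weight k * h (f k) = \sum_i regrouped f i * h i.
Proof.
rewrite (partition_big f predT)//=; apply: eq_bigr => i _.
by rewrite big_distrl/=; apply: eq_bigr => k /eqP ->.
Qed.

Lemma regrouped_inj p (f : 'I_(ncomp p) -> I) k : injective f ->
  regrouped f (f k) = weight k.
Proof.
move=> f_inj; rewrite /regrouped (eq_bigl (pred1 k)) ?big_pred1_eq// => l.
exact: (inj_eq f_inj).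
Qed.

(** Without a matching component of [q], the regrouped weight at [f k] would be an empty sum,
    against the positivity of [weight k]. *)
Lemma component_match p q (f : 'I_(ncomp p) -> I) (g : 'I_(ncomp q) -> I) k :
    injective f -> injective g -> 0 < weight k -> regrouped f =1 regrouped g ->
  exists2 l, g l = f k & weight l = weight k.
Proof.
move=> f_inj g_inj wk fg; have [l /eqP gl|noL] := pickP (fun l => g l == f k).
  by exists l => //; rewrite -(regrouped_inj l g_inj) gl -fg regrouped_inj.
have := fg (f k); rewrite regrouped_inj// /regrouped big_pred0// => w0.
by rewrite w0 ltxx in wk.
Qed.

Lemma components_sub p q (x : I -> R * R)
    (f : 'I_(ncomp p) -> I) (g : 'I_(ncomp q) -> I) :
    (forall k, x (f k) = (mean k, Defs.variance k)) ->
    (forall k, x (g k) = (mean k, Defs.variance k)) ->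
    admissible p -> admissible q -> regrouped f =1 regrouped g ->
  (ncomp p <= ncomp q)%N /\ components p `<=` components q.
Proof.
move=> xf xg [wp _ _ p_inj] [_ _ _ q_inj] fg.
have f_inj : injective f by move=> k l fkl; apply: p_inj; rewrite -!xf fkl.
have g_inj : injective g by move=> k l gkl; apply: q_inj; rewrite -!xg gkl.
have match_ k := component_match f_inj g_inj (wp k) fg.
split; last first.
  move=> _ [k _ <-]; have [l gl wl] := match_ k; exists l => //.
  by have := xg l; rewrite gl xf wl => -[-> ->].
(* The chosen match is an injection between the component indices, which compares the numbers of
   components. *)
pose h k := s2val (cid2 (match_ k)).
have gh k : g (h k) = f k by exact: (s2valP (cid2 (match_ k))).
have h_inj : injective h by move=> k l hkl; apply: f_inj; rewrite -!gh hkl.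
by have := leq_card h h_inj; rewrite !card_ord.
Qed.

End Regrouping.

Theorem theorem6 (R : realType) (F : cumulativeBounded (0 : R) (1 : R))
    (psi kappa varphi : R -> R)
    (F_strict : {homo F : x y / x < y})
    (psi_gt0 : forall s : R, 0 < s -> 0 < psi s)
    (varphi_gt0 : forall s : R, 0 < s -> 0 < varphi s)
    (kappa_incr : {homo kappa : x y / x <= y})
    (varphi_incr : forall s t : R, 0 < s -> s <= t -> varphi s <= varphi t)
    (condA : left_tail_condition F)
    (condB : right_tail_condition F) :
  identifiable F psi kappa varphi.
Proof.
move=> p q p_adm q_adm obs.
pose pair (r : mixture_params R) (k : 'I_(ncomp r)) := (mean k, Defs.variance k).
(* All (mean, variance) pairs of [p] and [q]; in [seq_sub X] a pair occurring in both is a single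
   index. *)
pose X := [seq pair p k | k <- enum 'I_(ncomp p)] ++
          [seq pair q k | k <- enum 'I_(ncomp q)].
have Xp k : pair p k \in X by rewrite mem_cat map_f ?mem_enum.
have Xq k : pair q k \in X by rewrite mem_cat orbC map_f ?mem_enum.
pose I := seq_sub X; pose f k : I := SeqSub (Xp k); pose g k : I := SeqSub (Xq k).
pose x (i : I) : R * R := val i.
have v_gt0 i : 0 < (x i).2.
  rewrite /x; have := valP i; rewrite mem_cat => /orP[] /mapP[k _ ->].
    by case: p_adm => _ _ + _; exact.
  by case: q_adm => _ _ + _; exact.
(* The factor 1 / sigma times the constant that separates the normal density from [gexp]. *)
pose c i := (Num.sqrt (x i).2)^-1 *
  (normal_peak 1 * expR (- ((x i).1 ^+ 2 / (2 * (x i).2)))).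
pose s i := (2 * (x i).2)^-1; pose m i := (x i).1 / (x i).2.
pose psi' i := psi (Num.sqrt (x i).2); pose phi i := varphi (Num.sqrt (x i).2).
pose kap i := kappa (x i).1.
have sd_gt0 i : 0 < Num.sqrt (x i).2 by rewrite sqrtr_gt0.
have c_gt0 i : 0 < c i.
  apply: mulr_gt0; first by rewrite invr_gt0.
  by apply: mulr_gt0; [rewrite normal_peak_gt0// oner_eq0|exact: expR_gt0].
have sm_inj : injective (fun i => (s i, m i)).
  move=> i j [/invr_inj sij mij]; apply: val_inj.
  have vij : (x i).2 = (x j).2 by apply: (mulfI _ sij); rewrite pnatr_eq0.
  have muij : (x i).1 = (x j).1.
    by move: mij; rewrite /m vij; apply: mulIf; rewrite invr_eq0 gt_eqF.
  by rewrite [LHS]surjective_pairing [RHS]surjective_pairing; congr (_, _).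
have obsE (r : mixture_params R) (h : 'I_(ncomp r) -> I) :
    (forall k, x (h k) = pair r k) ->
    forall y, observed_distribution F psi kappa varphi r y =
      weighted_mixture F c s psi' phi m kap (regrouped h) (alpha r) (beta r) y.
  move=> xh y; pose G i := c i * gexp (s i) (m i) y *
    selection F psi' phi kap (alpha r) (beta r) i y.
  transitivity (\sum_k weight k * G (h k)); last first.
    by rewrite sum_regrouped; apply: eq_bigr => i _; rewrite /G; ring.
  apply: eq_bigr => k _.
  have xhk : x (h k) = (mean k, Defs.variance k) by exact: xh.
  have vk : 0 < Defs.variance k by have := v_gt0 (h k); rewrite xhk.
  rewrite /G /c /s /m /psi' /phi /kap /selection /response_prob /psi' /phi /kap xhk /=.
  by rewrite /sd normal_pdf_gexp//; ring.
have sum1 (r : mixture_params R) (h : 'I_(ncomp r) -> I) :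
    admissible r -> \sum_i regrouped h i = 1.
  move=> [_ <- _ _]; transitivity (\sum_i regrouped h i * 1).
    by apply: eq_bigr => i _; rewrite mulr1.
  rewrite -(sum_regrouped h (fun=> 1)).
  by apply: eq_bigr => i _; rewrite mulr1.
have ge0 (r : mixture_params R) (h : 'I_(ncomp r) -> I) :
    admissible r -> forall i, 0 <= regrouped h i.
  by move=> [w0 _ _ _] i; apply: sumr_ge0 => k _; exact: ltW.
have [wE aE bE] := @weighted_mixture_identifiable R F F_strict I c s psi' phi
  c_gt0 (fun i => psi_gt0 _ (sd_gt0 i)) (fun i => varphi_gt0 _ (sd_gt0 i)) condA condB
  m kap (regrouped f) (regrouped g) (alpha p) (alpha q) (beta p) (beta q)
  sm_inj (ge0 _ _ p_adm) (sum1 _ _ p_adm) (ge0 _ _ q_adm) (sum1 _ _ q_adm)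
  (fun y => etrans (esym (obsE p f (fun=> erefl) y))
              (etrans (obs y) (obsE q g (fun=> erefl) y))).
have [pq_n pq] := @components_sub R I p q x f g (fun=> erefl) (fun=> erefl) p_adm q_adm wE.
have [qp_n qp] := @components_sub R I q p x g f (fun=> erefl) (fun=> erefl) q_adm p_adm
  (fsym wE).
split=> //; first by apply/eqP; rewrite eqn_leq pq_n.
by apply/seteqP; split.
Qed.
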